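(* Let $Z\subset \mathbb{CP}^1\times\mathbb{CP}^2\times\mathbb{CP}^2$ be the three-dimensional Bott-Samelson variety of $\mathrm{GL}_3(\mathbb{C})$ associated to the word $\mathbf{i}=(1,2,1)$, polarized by the restriction to $Z$ of the line bundle $\mathcal{O}(1)\boxtimes\mathcal{O}(1)\boxtimes\mathcal{O}(1)$. Then the Hilbert polynomial of $Z$ is $$\mathrm{HP}_Z(s)=\frac{5s^3+11s^2+8s+2}{2}.$$
   Context: Let $P_1,P_2\subset\mathrm{GL}_3(\mathbb{C})$ be the parabolic subgroups of block upper triangular matrices with diagonal block sizes $(2,1)$ and $(1,2)$ respectively, and $B$ the group of upper triangular matrices. The Bott-Samelson variety is $Z=P_1\times P_2\times P_1/B^3$, where $(b_1,b_2,b_3)\in B^3$ acts by $(p_1,p_2,p_3)\cdot(b_1,b_2,b_3)=(p_1b_1,\,b_1^{-1}p_2b_2,\,b_2^{-1}p_3b_3)$. It is embedded in $\mathbb{CP}^1\times\mathbb{CP}^2\times\mathbb{CP}^2$, with homogeneous coordinates $[s_1:s_2]$, $[r_{23}:r_{13}:r_{12}]$, $[q_1:q_2:q_3]$, by letting $s_i$ be the entry in row $i$, column $1$ of $p_1$; $r_{ij}$ the $2\times2$ minor of $p_1p_2$ with rows $i,j$ and columns $1,2$; and $q_i$ the entry in row $i$, column $1$ of $p_1p_2p_3$. Under this embedding $Z$ is the subvariety defined by the two equations $$s_1r_{23}-s_2r_{13}=0,\qquad q_1r_{23}-q_2r_{13}+q_3r_{12}=0.$$ The Hilbert polynomial $\mathrm{HP}_Z(s)$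 is the polynomial that coincides, for all sufficiently large integers $s$, with $\dim_{\mathbb{C}} H^0\big(Z,(\mathcal{O}(1)\boxtimes\mathcal{O}(1)\boxtimes\mathcal{O}(1))^{\otimes s}|_Z\big)$. *)

(* Defs.v *)
From HB Require Import structures.
From mathcomp Require Import all_boot all_order all_algebra.
From mathcomp Require Import ring mpoly.
From mathcomp Require Import reals.
From mathcomp.real_closed Require Import complex.

Set Implicit Arguments.
Unset Strict Implicit.
Unset Printing Implicit Defensive.

Import GRing.Theory.
Local Open Scope ring_scope.

Section BottSamelson.
Variable K : fieldType.

Definition in_B (b : 'M[K]_3) : Prop := b \in unitmx /\ is_trig_mx b^T.

Definition in_P1 (p : 'M[K]_3) : Prop :=
  p \in unitmx /\ dlsubmx (p : 'M_(2 + 1, 2 + 1)) = 0.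

Definition in_P2 (p : 'M[K]_3) : Prop :=
  p \in unitmx /\ dlsubmx (p : 'M_(1 + 2, 1 + 2)) = 0.

(* Rows and columns are numbered from 0. *)
Definition s_coord (p1 : 'M[K]_3) : 'rV[K]_2 :=
  \row_(i < 2) p1 (lift ord_max i) 0.

(* The k-th entry is the minor on the first two columns that omits row k, so
   that the entries come in the order r_23, r_13, r_12. *)
Definition r_coord (p12 : 'M[K]_3) : 'rV[K]_3 :=
  \row_(k < 3) \det (row' k (col' ord_max p12)).

Definition q_coord (p123 : 'M[K]_3) : 'rV[K]_3 := \row_(i < 3) p123 i 0.

Definition point : Type := ('rV[K]_2 * 'rV[K]_3 * 'rV[K]_3)%type.

Definition bs_embed (p1 p2 p3 : 'M[K]_3) : point :=
  (s_coord p1, r_coord (p1 *m p2), q_coord (p1 *m p2 *m p3)).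

(* Homogeneous coordinates of the same point of P^1 x P^2 x P^2. *)
Definition proj_eq (x y : point) : Prop :=
  exists a b c : K, [/\ a != 0, b != 0, c != 0 &
    y = (a *: x.1.1, b *: x.1.2, c *: x.2)].

Definition same_orbit (p1 p2 p3 p1' p2' p3' : 'M[K]_3) : Prop :=
  exists b1 b2 b3 : 'M[K]_3, [/\ in_B b1, in_B b2, in_B b3 &
    [/\ p1' = p1 *m b1, p2' = invmx b1 *m p2 *m b2
      & p3' = invmx b2 *m p3 *m b3]].

Lemma sum3 (F : 'I_3 -> K) : \sum_i F i = F 0 + F 1 + F ord_max.
Proof.
rewrite !big_ord_recl big_ord0 addr0 addrA.
by congr (_ + _ + _); congr F; apply/val_inj.
Qed.

Lemma ord3P (i : 'I_3) : [\/ i = 0, i = 1 | i = ord_max].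
Proof.
by case: i => [[|[|[|//]]] Hi]; [constructor 1|constructor 2|constructor 3];
  apply/val_inj.
Qed.

Lemma in_BP (b : 'M[K]_3) : in_B b <->
  [/\ b \in unitmx, b 1 0 = 0, b ord_max 0 = 0 & b ord_max 1 = 0].
Proof.
split=> [[ub /is_trig_mxP tb]|[ub b10 b20 b21]].
  by split=> //; [have := tb 0 1 | have := tb 0 ord_max | have := tb 1 ord_max];
    rewrite mxE; exact.
split=> //; apply/is_trig_mxP => i j; rewrite mxE.
by case: (ord3P i) (ord3P j) => -> [] ->.
Qed.

Lemma in_P1P (p : 'M[K]_3) : in_P1 p <->
  [/\ p \in unitmx, p ord_max 0 = 0 & p ord_max 1 = 0].
Proof.
have E (k : 'I_2) : dlsubmx (p : 'M_(2 + 1, 2 + 1)) 0 k =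
    p ord_max (lift ord_max k).
  by rewrite /dlsubmx !mxE; congr (p _ _); apply/val_inj; case: k => -[|[]].
have l0 : lift ord_max (0 : 'I_2) = 0 :> 'I_3 by apply/val_inj.
have l1 : lift ord_max (1 : 'I_2) = 1 :> 'I_3 by apply/val_inj.
split=> [[up p0]|[up p20 p21]].
  by split; rewrite // -?l0 -?l1 -E p0 mxE.
split=> //; apply/matrixP => i j; rewrite (ord1 i) E mxE.
case: j => -[|[|//]] Hj.
  by rewrite -p20; congr (p _ _); apply/val_inj.
by rewrite -p21; congr (p _ _); apply/val_inj.
Qed.

Lemma in_P2P (p : 'M[K]_3) : in_P2 p <->
  [/\ p \in unitmx, p 1 0 = 0 & p ord_max 0 = 0].
Proof.
have E (k : 'I_2) : dlsubmx (p : 'M_(1 + 2, 1 + 2)) k 0 = p (lift 0 k) 0.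
  by rewrite /dlsubmx !mxE; congr (p _ _); apply/val_inj; case: k => -[|[]].
have l0 : lift 0 (0 : 'I_2) = 1 :> 'I_3 by apply/val_inj.
have l1 : lift 0 (1 : 'I_2) = ord_max :> 'I_3 by apply/val_inj.
split=> [[up p0]|[up p10 p20]].
  by split; rewrite // -?l0 -?l1 -E p0 mxE.
split=> //; apply/matrixP => i j; rewrite (ord1 j) E mxE.
case: i => -[|[|//]] Hi.
  by rewrite -p10; congr (p _ _); apply/val_inj.
by rewrite -p20; congr (p _ _); apply/val_inj.
Qed.

Lemma in_B_diag (b : 'M[K]_3) : in_B b ->
  [/\ b 0 0 != 0, b 1 1 != 0 & b ord_max ord_max != 0].
Proof.
move=> [ub tb]; move: ub; rewrite unitmxE unitfE -det_tr det_trig //.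
move/prodf_neq0 => H.
by split; [move: (H 0 isT)|move: (H 1 isT)|move: (H ord_max isT)]; rewrite mxE.
Qed.

Lemma P1_row (p b : 'M[K]_3) j :
  in_P1 p -> (p *m b) ord_max j = 0 -> b ord_max j = 0.
Proof.
move=> /in_P1P[up p20 p21]; rewrite mxE sum3 p20 p21 !mul0r !add0r.
move/eqP; rewrite mulf_eq0 => /orP[/eqP p22|/eqP //].
have : (p *m invmx p) ord_max ord_max = 1 by rewrite mulmxV // mxE eqxx.
rewrite mxE sum3 p20 p21 p22 !mul0r !add0r => /eqP.
by rewrite eq_sym oner_eq0.
Qed.

Lemma unit_col (p b : 'M[K]_3) (c : K) : p \in unitmx ->
  (forall i, (p *m b) i 0 = c * p i 0) -> b 1 0 = 0 /\ b ord_max 0 = 0.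
Proof.
move=> up H.
have E : col 0 (p *m b) = c *: col 0 p by apply/matrixP => i j; rewrite !mxE -H mxE.
have {E}: col 0 b = c *: col 0 1%:M.
  have -> : col 0 b = invmx p *m col 0 (p *m b).
    by rewrite !colE !mulmxA mulVmx // mul1mx.
  by rewrite E -scalemxAr !colE mulmxA mulVmx.
by move/matrixP => E; split; [have := E 1 0|have := E ord_max 0];
  rewrite !mxE /= mulr0.
Qed.

Lemma det_2x2 (A : 'M[K]_2) : \det A = A 0 0 * A 1 1 - A 0 1 * A 1 0.
Proof.
rewrite (expand_det_row _ 0) !big_ord_recl big_ord0 addr0 /cofactor !det_mx11.
rewrite !mxE /= expr0 mul1r expr1 mulN1r mulrN.
by congr (A _ _ * A _ _ - A _ _ * A _ _); apply/val_inj.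
Qed.

Lemma r_coordE (N : 'M[K]_3) : [/\
  r_coord N 0 0 = N 1 0 * N ord_max 1 - N 1 1 * N ord_max 0,
  r_coord N 0 1 = N 0 0 * N ord_max 1 - N 0 1 * N ord_max 0
  & r_coord N 0 ord_max = N 0 0 * N 1 1 - N 0 1 * N 1 0].
Proof.
by split; rewrite mxE det_2x2 !mxE;
  congr (N _ _ * N _ _ - N _ _ * N _ _); apply/val_inj.
Qed.

Lemma r_coord_det (N : 'M[K]_3) : \det N = r_coord N 0 0 * N 0 ord_max
  - r_coord N 0 1 * N 1 ord_max + r_coord N 0 ord_max * N ord_max ord_max.
Proof.
rewrite (expand_det_col _ ord_max) sum3 /cofactor !mxE /=; ring.
Qed.

Lemma bs_embed_orbitP (p1 p2 p3 p1' p2' p3' : 'M[K]_3) :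
  in_P1 p1 -> in_P2 p2 -> in_P1 p3 ->
  in_P1 p1' -> in_P2 p2' -> in_P1 p3' ->
  proj_eq (bs_embed p1 p2 p3) (bs_embed p1' p2' p3') <->
  same_orbit p1 p2 p3 p1' p2' p3'.
Proof.
move=> P1p1 P2p2 P1p3 P1p1' P2p2' P1p3'.
have [u1 p1_20 p1_21] := (in_P1P _).1 P1p1.
have [u2 p2_10 p2_20] := (in_P2P _).1 P2p2.
have [u3 p3_20 p3_21] := (in_P1P _).1 P1p3.
have [u1' p1'_20 p1'_21] := (in_P1P _).1 P1p1'.
have [u2' p2'_10 p2'_20] := (in_P2P _).1 P2p2'.
have [u3' p3'_20 p3'_21] := (in_P1P _).1 P1p3'.
split; last first.
  move=> [b1 [b2 [b3 [Bb1 Bb2 Bb3 [E1 E2 E3]]]]].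
  have [n1 _ _] := in_B_diag Bb1; have [n2 n2' _] := in_B_diag Bb2.
  have [n3 _ _] := in_B_diag Bb3.
  have [v1 b1_10 b1_20 _] := (in_BP _).1 Bb1.
  have [v2 b2_10 b2_20 b2_21] := (in_BP _).1 Bb2.
  have [v3 b3_10 b3_20 _] := (in_BP _).1 Bb3.
  exists (b1 0 0), (b2 0 0 * b2 1 1), (b3 0 0); split=> //; first by rewrite mulf_neq0.
  have E12 : p1' *m p2' = p1 *m p2 *m b2.
    by rewrite E1 E2 -!mulmxA mulKVmx.
  have E123 : p1' *m p2' *m p3' = p1 *m p2 *m p3 *m b3.
    by rewrite E12 E3 -!mulmxA mulKVmx.
  rewrite /bs_embed E123 E12 E1 /=; congr (_, _, _).
  - by apply/rowP => i; rewrite !mxE sum3 b1_10 b1_20 !mulr0 !addr0 mulrC.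
  - set N := p1 *m p2; apply/rowP => k; rewrite [RHS]mxE.
    have [A0 A1 A2] := r_coordE N; have [C0 C1 C2] := r_coordE (N *m b2).
    have N0 i : (N *m b2) i 0 = N i 0 * b2 0 0.
      by rewrite mxE sum3 b2_10 b2_20 !mulr0 !addr0.
    have N1 i : (N *m b2) i 1 = N i 0 * b2 0 1 + N i 1 * b2 1 1.
      by rewrite mxE sum3 b2_21 mulr0 addr0.
    case: (ord3P k) => ->.
    + rewrite C0 A0 !N0 !N1; ring.
    + rewrite C1 A1 !N0 !N1; ring.
    + rewrite C2 A2 !N0 !N1; ring.
  - set M := p1 *m p2 *m p3; apply/rowP => i.
    have -> : q_coord (M *m b3) 0 i = (M *m b3) i 0 by rewrite mxE.
    have -> : (b3 0 0 *: q_coord M) 0 i = b3 0 0 * M i 0 by rewrite [LHS]mxE [X in _ * X]mxE.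
    by rewrite mxE sum3 b3_10 b3_20 !mulr0 !addr0 mulrC.
move=> [a [b [c [a0 b0 c0 [Es Er Eq]]]]].
pose N := p1 *m p2; pose N' := p1' *m p2'.
pose b1 := invmx p1 *m p1'; pose b2 := invmx N *m N'.
pose b3 := invmx (N *m p3) *m (N' *m p3').
have uN : N \in unitmx by rewrite unitmx_mul u1.
have uN' : N' \in unitmx by rewrite unitmx_mul u1'.
have uM : N *m p3 \in unitmx by rewrite unitmx_mul uN.
have uM' : N' *m p3' \in unitmx by rewrite unitmx_mul uN'.
have K1 : p1 *m b1 = p1' by rewrite mulKVmx.
have K2 : N *m b2 = N' by rewrite mulKVmx.
have K3 : N *m p3 *m b3 = N' *m p3' by rewrite mulKVmx.
have v1 : b1 \in unitmx by rewrite unitmx_mul unitmx_inv u1.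
have v2 : b2 \in unitmx by rewrite unitmx_mul unitmx_inv uN.
have v3 : b3 \in unitmx by rewrite unitmx_mul unitmx_inv uM.
clearbody b1 b2 b3.
have K2' : p2 *m b2 = b1 *m p2'.
  by apply: (can_inj (mulKmx u1)); rewrite 2!mulmxA -/N K2 K1.
have K3' : p3 *m b3 = b2 *m p3'.
  by apply: (can_inj (mulKmx uN)); rewrite 2!mulmxA K3 K2.
have c1 i : p1' i 0 = a * p1 i 0.
  have [k ->|->] := unliftP ord_max i; last by rewrite p1_20 p1'_20 mulr0.
  by move/rowP: Es => /(_ k); rewrite !mxE.
have Bb1 : in_B b1.
  apply/in_BP; have [|h1 h2] := @unit_col p1 b1 a u1.
    by move=> i; rewrite K1 c1.
  by split=> //; apply: (@P1_row p1) => //; rewrite K1.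
have cN i : N i 0 = p2 0 0 * p1 i 0.
  by rewrite mxE sum3 p2_10 p2_20 !mulr0 !addr0 mulrC.
have cN' i : N' i 0 = p2' 0 0 * p1' i 0.
  by rewrite mxE sum3 p2'_10 p2'_20 !mulr0 !addr0 mulrC.
have p200 : p2 0 0 != 0.
  apply/eqP => p200; have : (invmx p2 *m p2) 0 0 = 1 by rewrite mulVmx // mxE eqxx.
  rewrite mxE sum3 p200 p2_10 p2_20 !mulr0 !addr0 => /eqP.
  by rewrite eq_sym oner_eq0.
have [b2_10 b2_20] : b2 1 0 = 0 /\ b2 ord_max 0 = 0.
  apply: (@unit_col N _ (p2' 0 0 * a / p2 0 0)) => // i.
  by rewrite K2 cN' cN c1; field.
have Bb2 : in_B b2.
  apply/in_BP; split=> //.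
  have [A0 A1 A2] := r_coordE N; have [C0 C1 C2] := r_coordE N'.
  have D : b * (\det N * b2 ord_max 1) = 0.
    transitivity (r_coord N' 0 0 * N' 0 1 - r_coord N' 0 1 * N' 1 1
                  + r_coord N' 0 ord_max * N' ord_max 1); last first.
      by rewrite C0 C1 C2; ring.
    have -> : r_coord N' = b *: r_coord N by [].
    have E i : N' i 1 = N i 0 * b2 0 1 + N i 1 * b2 1 1 + N i ord_max * b2 ord_max 1.
      by rewrite -K2 mxE sum3.
    have Z k : (b *: r_coord N) 0 k = b * r_coord N 0 k by rewrite mxE.
    by rewrite r_coord_det !E !Z A0 A1 A2; ring.
  move/eqP: D; rewrite !mulf_eq0 (negbTE b0) /=.
  by move: uN; rewrite unitmxE unitfE => /negbTE -> /eqP.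
have Bb3 : in_B b3.
  apply/in_BP; have [|h1 h2] := @unit_col (N *m p3) b3 c uM.
    by move=> i; rewrite K3; move/rowP: Eq => /(_ i); rewrite !mxE.
  split=> //; apply: (@P1_row p3) => //; rewrite K3'.
  have [_ _ b20 b21] := (in_BP _).1 Bb2.
  by rewrite mxE sum3 b20 b21 p3'_21 !mul0r mulr0 !addr0.
exists b1, b2, b3; split=> //.
by rewrite K1 -!mulmxA K2' K3' !mulKmx.
Qed.

(* The multicone over Z: all homogeneous coordinates of all points in the
   image of P_1 x P_2 x P_1.  By [bs_embed_orbitP] this image is in bijection
   with the quotient by B^3. *)
Definition bs_cone (x : point) : Prop :=
  exists p1 p2 p3 : 'M[K]_3,
    [/\ in_P1 p1, in_P2 p2, in_P1 p3 & proj_eq (bs_embed p1 p2 p3) x].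

(* The variables are s_1, s_2, then r_23, r_13, r_12, then q_1, q_2, q_3. *)
Definition coord_poly : Type := {mpoly K[2 + 3 + 3]}.

Definition eval_at (f : coord_poly) (x : point) : K :=
  f.@[fun i => row_mx (row_mx x.1.1 x.1.2) x.2 0 i].

Definition multihomog (a b c : nat) (f : coord_poly) : Prop :=
  forall m : 'X_{1.. 2 + 3 + 3}, m \in msupp f ->
    [/\ (\sum_(i < 2) m (lshift 3 (lshift 3 i)))%N = a,
        (\sum_(i < 3) m (lshift 3 (rshift 2 i)))%N = b
      & (\sum_(i < 3) m (rshift (2 + 3) i))%N = c].

(* A section over X of O(d1) x O(d2) x O(d3), where the reduced closed subvariety
   X is given by its multicone, is a function on the multicone that is Zariski
   locally a quotient f / g of multihomogeneous polynomials with
   deg f - deg g = (d1, d2, d3).  The neighbourhood of x on which sigma = f / g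
   can be shrunk to a basic open set, which, multiplying f and g by its
   equation, can be taken to be the locus g <> 0. *)
Definition is_section (X : point -> Prop) (d1 d2 d3 : nat)
    (sigma : {x : point | X x} -> K) : Prop :=
  forall x : {x : point | X x}, exists (a b c : nat) (f g : coord_poly),
    [/\ multihomog (a + d1) (b + d2) (c + d3) f, multihomog a b c g,
        eval_at g (sval x) != 0
      & forall y : {y : point | X y}, eval_at g (sval y) != 0 ->
          sigma y = eval_at f (sval y) / eval_at g (sval y)].

Definition has_dim (T : Type) (V : (T -> K) -> Prop) (d : nat) : Prop :=
  exists e : 'I_d -> T -> K,
    (forall c : 'I_d -> K,
        (forall x, \sum_(i < d) c i * e i x = 0) -> forall i, c i = 0) /\
    (forall sigma : T -> K,
        V sigma <->
        exists c : 'I_d -> K, forall x, sigma x = \sum_(i < d) c i * e i x).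

Definition is_Hilbert_poly (X : point -> Prop) (P : {poly rat}) : Prop :=
  exists N : nat, forall s : nat, (N <= s)%N ->
    exists2 d : nat, has_dim (@is_section X s s s) d & P.[s%:R] = d%:R.

End BottSamelson.

(* Main.v *)
(* On Z put (r23, r13) = t (s2, s1).  Where r12 <> 0 we may take r12 = 1, and the
   equations of Z leave (s, t, q1, q2) free, with q3 = t (q2 s1 - q1 s2): this open
   set is P^1 x A^1 x P^1 up to twists.  A section of O(n,n,n) restricts to a
   polynomial on every rational curve parametrized by polynomials.  Its behaviour at
   infinity in the three coordinate directions shows that it is
   sum_(i <= 2n) A_i(s, q) t^i with A_i bihomogeneous of bidegree (n + i, n).
   Regularity across the divisor r12 = 0 amounts to A_i being divisible by
   (q2 s1 - q1 s2)^(i - n) for i > n.  Conversely, such an expression is a polynomial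
   in the coordinates of Z.  The dimension is thus
   sum_(i <= n) (n + i + 1)(n + 1) + sum_(1 <= k <= n) (2n + 1)(n - k + 1). *)
Require Import Defs.
From HB Require Import structures.
From mathcomp Require Import all_boot all_order all_algebra.
From mathcomp Require Import ring zify mpoly.
From mathcomp Require Import reals.
From mathcomp.real_closed Require Import complex.

Set Implicit Arguments.
Unset Strict Implicit.
Unset Printing Implicit Defensive.

Import GRing.Theory Num.Theory.
Local Open Scope ring_scope.

(** * Polynomial functions *)

Lemma natr_inj (K : numDomainType) : injective (fun i : nat => i%:R : K).
Proof. by move=> i j /eqP; rewrite eqr_nat => /eqP. Qed.

Lemma poly_eq_eventually (K : numDomainType) (p q : {poly K}) N :
  (forall s, (N <= s)%N -> p.[s%:R] = q.[s%:R]) -> p = q.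
Proof.
move=> E; apply/eqP; rewrite -subr_eq0; apply: contraT => pq0.
have := @max_poly_roots _ (p - q) [seq i%:R | i <- iota N (size (p - q))] pq0.
rewrite size_map size_iota ltnn; apply.
  apply/allP => _ /mapP[i + ->]; rewrite mem_iota => /andP[Ni _].
  by rewrite /root hornerD hornerN E // subrr.
by rewrite map_inj_uniq ?iota_uniq //; apply: natr_inj.
Qed.

Section PolynomialFunctions.
Variable K : numClosedFieldType.
Implicit Types p q f g : {poly K}.

(** Unless [p + 1] is a nonzero constant it has a root, and there [p] takes the value -1. *)
Lemma poly_fun0 p : (forall x, p.[x] = 0) -> p = 0.
Proof.
move=> p0; have [/size_poly1P[c _ Dp]|] := boolP (size (p + 1) == 1%N).
  have Dp' : p = (c - 1)%:P by rewrite polyCB -Dp addrK.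
  by have := p0 0; rewrite Dp' hornerC => ->; rewrite polyC0.
case/closed_rootP => x; rewrite /root hornerD p0 hornerC add0r.
by rewrite (negbTE (oner_neq0 _)).
Qed.

Lemma poly_fun0_ae p g :
  g != 0 -> (forall x, g.[x] != 0 -> p.[x] = 0) -> p = 0.
Proof.
move=> g0 H; suff /eqP : p * g = 0 by rewrite mulf_eq0 (negbTE g0) orbF => /eqP.
apply: poly_fun0 => x; rewrite hornerM.
by have [->|/H->] := eqVneq g.[x] 0; rewrite ?mulr0 ?mul0r.
Qed.

Lemma poly_fun_eq_ae p q g :
  g != 0 -> (forall x, g.[x] != 0 -> p.[x] = q.[x]) -> p = q.
Proof.
move=> g0 H; apply/eqP; rewrite -subr_eq0; apply/eqP/(poly_fun0_ae g0) => x gx.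
by rewrite hornerD hornerN H // subrr.
Qed.

Lemma poly_neq0_at g (x : K) : g.[x] != 0 -> g != 0.
Proof. by apply: contraNneq => ->; rewrite horner0. Qed.

(* In lowest terms, a denominator of [h] near one point divides the denominators
   of [h] near all the others, so it has no zero at all. *)
Lemma locally_rational_poly (h : K -> K) :
  (forall x0, exists f g, g.[x0] != 0 /\
     forall x, g.[x] != 0 -> h x = f.[x] / g.[x]) ->
  exists p, forall x, h x = p.[x].
Proof.
move=> H; have [f0 [g0 [g00 H0]]] := H 0.
have g0n := poly_neq0_at g00.
pose d := gcdp f0 g0; pose f1 := f0 %/ d; pose g1 := g0 %/ d.
have d0 : d != 0 by rewrite gcdp_eq0 (negbTE g0n) andbF.
have Df : f0 = f1 * d by rewrite divpK ?dvdp_gcdl.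
have Dg : g0 = g1 * d by rewrite divpK ?dvdp_gcdr.
have cop : coprimep f1 g1 by rewrite coprimep_div_gcd // g0n orbT.
have H1 x : g0.[x] != 0 -> h x = f1.[x] / g1.[x].
  move=> gx; rewrite (H0 x gx); move: gx; rewrite Df Dg !hornerM mulf_eq0.
  by case/norP => g1x dx; field; rewrite g1x dx.
have cross x0 : exists f g, [/\ g.[x0] != 0, f * g1 = f1 * g
    & forall x, g.[x] != 0 -> h x = f.[x] / g.[x]].
  have [f [g [gx0 Hx]]] := H x0; exists f, g; split=> //.
  apply: (@poly_fun_eq_ae _ _ (g0 * g)) => [|x].
    by rewrite mulf_neq0 // (poly_neq0_at gx0).
  rewrite !hornerM mulf_eq0 => /norP[g0x gx].
  have g1x : g1.[x] != 0.
    by move: g0x; rewrite Dg hornerM mulf_eq0 => /norP[].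
  have := H1 x g0x; rewrite (Hx x gx) => E.
  by apply/eqP; rewrite -eqr_div // E.
have [/size_poly1P[c c0 Dg1]|] := boolP (size g1 == 1%N); last first.
  case/closed_rootP => x0 rx0; have [f [g [gx0 E _]]] := cross x0.
  have f1x0 : root f1 x0.
    move/(congr1 (horner^~ x0)): E; rewrite /= !hornerM (rootP rx0) mulr0.
    by move/esym/eqP; rewrite mulf_eq0 (negbTE gx0) orbF.
  by have := coprimep_root cop f1x0; rewrite (rootP rx0) eqxx.
exists (c^-1 *: f1) => x; have [f [g [gx E ->]]] := cross x => //.
move/(congr1 (horner^~ x)): E; rewrite /= !hornerM Dg1 hornerC hornerZ => E.
by apply: (mulIf c0); rewrite mulrAC E; field; rewrite gx c0.
Qed.

(* [q] is [p] in the coordinate at infinity, [p] being seen as a form of degree [n]. *)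
Lemma size_poly_inv (n : nat) p q :
  (forall z, z != 0 -> q.[z] = z ^+ n * p.[z^-1]) -> (size p <= n.+1)%N.
Proof.
move=> H; rewrite leqNgt; apply/negP => lt_n.
pose m := (size p).-1; have Dm : size p = m.+1 by rewrite /m; lia.
have lt_nm : (n < m)%N by lia.
(* [r] reverses the coefficients of [p], so its value at 0 is the leading coefficient of [p]; but
   the factor ['X^(m - n)] makes it vanish there. *)
pose r := \poly_(i < m.+1) p`_(m - i).
have Er : r = 'X^(m - n) * q.
  apply: (@poly_fun_eq_ae _ _ 'X); first by rewrite polyX_eq0.
  move=> z; rewrite hornerX => z0; rewrite hornerM hornerXn H // mulrA -exprD.
  rewrite subnK 1?ltnW // horner_poly horner_coef Dm mulr_sumr.
  rewrite (reindex_inj rev_ord_inj); apply: eq_bigr => i _ /=.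
  rewrite subSS (subKn (_ : (i <= m)%N)); last by rewrite -ltnS.
  have im : (i <= m)%N by rewrite -ltnS.
  rewrite mulrCA; congr (_ * _).
  have -> : z ^+ m = z ^+ (m - i) * z ^+ i by rewrite -exprD subnK.
  by rewrite exprVn mulfK // expf_neq0.
have := congr1 (horner^~ 0) Er; rewrite /= hornerM hornerXn expr0n.
have -> : (m - n == 0)%N = false by lia.
rewrite mul0r horner_coef0 coef_poly /= subn0 => /eqP.
by rewrite /m -lead_coefE lead_coef_eq0 -size_poly_eq0 Dm.
Qed.

Lemma lagrange_interp (d : nat) : exists L : 'I_d -> {poly K},
  (forall j, size (L j) <= d)%N /\
  forall p, (size p <= d)%N -> p = \sum_(j < d) p.[j%:R] *: L j.
Proof.
case: d => [|d].
  exists (fun => 0); split=> [j|p]; first by rewrite size_poly0.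
  by rewrite big_ord0 leqn0 size_poly_eq0 => /eqP.
pose x i : K := i%:R.
exists (fun j => tnth (lagrange d.+1 x) j : {poly K}); split=> [j|p sp].
  by rewrite size_lagrange_ //; apply: natr_inj.
rewrite [LHS](@lagrange_gen _ d.+1 x) //; last exact: natr_inj.
by apply: eq_bigr => i _; rewrite mul_polyC.
Qed.

(** The entries of [M] are the coefficients of the Lagrange polynomials at the nodes 0, ..., d - 1.
    Coefficients thus become linear combinations of values, with weights common to all polynomials;
    this carries regularity of values over to coefficients. *)
Lemma vandermonde_inv (d : nat) : exists M : 'I_d -> 'I_d -> K,
  forall (c : 'I_d -> K) i,
    \sum_(j < d) (\sum_(l < d) c l * j%:R ^+ l) * M j i = c i.
Proof.
have [L [_ DL]] := lagrange_interp d; exists (fun j i => (L j)`_i) => c i.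
pose p := \sum_(l < d) c l *: 'X^l.
have p_coef (l : 'I_d) : p`_l = c l.
  rewrite coef_sum (bigD1 l) //= coefZ coefXn eqxx mulr1 big1 ?addr0 // => j jl.
  by rewrite coefZ coefXn eq_sym -[(_ == _)%N]/(j == l) (negbTE jl) mulr0.
have sp : (size p <= d)%N.
  rewrite (leq_trans (size_sum _ _ _)) //; apply/bigmax_leqP => l _.
  by rewrite (leq_trans (size_scale_leq _ _)) // size_polyXn.
rewrite -p_coef (DL p sp) coef_sum; apply: eq_bigr => j _.
rewrite coefZ horner_sum; congr (_ * _); apply: eq_bigr => l _.
by rewrite hornerZ hornerXn.
Qed.

Lemma horner_eval_inner (A : {poly {poly K}}) (q : {poly K}) x :
  A.[q].[x] = A.[q.[x]%:P].[x].
Proof.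
rewrite (horner_coef A q) (horner_coef A q.[x]%:P) !horner_sum.
apply: eq_bigr => i _.
by rewrite !hornerM !horner_exp hornerC.
Qed.

(* Here and below the outer variable of a bivariate polynomial is the second
   argument of the function that it represents. *)
Lemma bivariate_interp (d e : nat) (F : K -> K -> K) :
  (forall y, exists2 p : {poly K}, (size p <= d)%N & forall x, F x y = p.[x]) ->
  (forall x, exists2 p : {poly K}, (size p <= e)%N & forall y, F x y = p.[y]) ->
  exists A : {poly {poly K}}, [/\ (size A <= e)%N, (sizeY A <= d)%N
    & forall x y, F x y = A.[y%:P].[x]].
Proof.
move=> Hx Hy; have [L [sL DL]] := lagrange_interp d.
have [M [sM DM]] := lagrange_interp e.
(* Interpolation of [F] on a grid, with [L] in the inner and [M] in the outer variable. *)
pose A := \sum_(j < e) \sum_(i < d) (F i%:R j%:R *: L i) *: (M j)^:P.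
exists A; split=> [||x y].
- rewrite (leq_trans (size_sum _ _ _)) //; apply/bigmax_leqP => j _.
  rewrite (leq_trans (size_sum _ _ _)) //; apply/bigmax_leqP => i _.
  by rewrite (leq_trans (size_scale_leq _ _)) // size_map_polyC.
- rewrite sizeYE /A raddf_sum (leq_trans (size_sum _ _ _)) //.
  apply/bigmax_leqP => j _; rewrite raddf_sum (leq_trans (size_sum _ _ _)) //.
  apply/bigmax_leqP => i _.
  rewrite -[_ *: (M j)^:P]mul_polyC [X in size X]/= rmorphM /= swapXY_polyC
    swapXY_map_polyC mulrC mul_polyC.
  rewrite (leq_trans (size_scale_leq _ _)) // size_map_polyC.
  by rewrite (leq_trans (size_scale_leq _ _)).
rewrite /A !horner_sum; have [p sp Dp] := Hy x.
rewrite Dp [p in LHS]DM // horner_sum; apply: eq_bigr => j _.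
rewrite hornerZ -Dp horner_sum horner_sum; have [q sq Dq] := Hx j%:R.
rewrite Dq [q in LHS]DL // horner_sum mulr_suml; apply: eq_bigr => i _.
by rewrite -Dq !hornerZ hornerM hornerZ horner_map hornerC.
Qed.

(** Adding the inner variable to the outer one turns divisibility by a power of their difference
    into divisibility by a power of ['X]. The factor split off has degree [k] in either variable, so
    both sizes drop by [k]. *)
Lemma dvd_diagonal (A : {poly {poly K}}) (k : nat) :
  (forall l, (l < k)%N -> (A \Po ('X + 'X%:P))`_l = 0) ->
  exists B : {poly {poly K}}, [/\ (size B <= size A - k)%N,
    (sizeY B <= sizeY A - k)%N & A = ('X - 'X%:P) ^+ k * B].
Proof.
move=> H; pose A' := A \Po ('X + 'X%:P).
have DA' : A' = drop_poly k A' * 'X^k.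
  rewrite -[LHS](poly_take_drop k); suff -> : take_poly k A' = 0 by rewrite add0r.
  by apply/polyP => l; rewrite coef_take_poly coef0; case: ifP => // /H.
pose B := drop_poly k A' \Po ('X - 'X%:P).
have DA : A = ('X - 'X%:P) ^+ k * B.
  transitivity (A' \Po ('X - 'X%:P)).
    rewrite /A' -comp_polyA comp_polyD comp_polyX comp_polyC subrK.
    by rewrite comp_polyXr.
  by rewrite DA' comp_polyM comp_Xn_poly mulrC.
exists B; have [B0|B0] := eqVneq B 0.
  by rewrite DA B0 mulr0 sizeYE raddf0 !size_poly0; split; rewrite ?mulr0.
have n1 : 'X - 'X%:P != 0 :> {poly {poly K}} by rewrite polyXsubC_eq0.
have s1 (c : {poly K}) : (size (('X - c%:P) ^+ k) = k.+1)%N.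
  by rewrite size_exp_XsubC.
split=> //.
  by rewrite [in leqRHS]DA size_mul ?expf_neq0 // s1 addSn /= addKn.
have s2 : size (('X%:P - 'X : {poly {poly K}}) ^+ k) = k.+1.
  by rewrite -opprB exprNn -signr_odd mulr_sign; case: odd; rewrite ?size_polyN s1.
rewrite !sizeYE [in leqRHS]DA rmorphM rmorphXn rmorphB /= swapXY_X swapXY_Y.
rewrite size_mul ?swapXY_eq0 // ?s2 ?addSn /= ?addKn //.
by rewrite -size_poly_eq0 s2.
Qed.

Lemma poly_coefs0 (n : nat) (c : 'I_n -> K) g : g != 0 ->
  (forall x, g.[x] != 0 -> \sum_(i < n) c i * x ^+ i = 0) -> forall i, c i = 0.
Proof.
move=> g0 H i; pose p := \sum_(i < n) c i *: 'X^i.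
have p0 : p = 0.
  apply: (poly_fun0_ae g0) => x /H <-; rewrite horner_sum.
  by apply: eq_bigr => j _; rewrite hornerZ hornerXn.
have := congr1 (fun p : {poly K} => p`_i) p0; rewrite coef0 coef_sum (bigD1 i) //=.
rewrite coefZ coefXn eqxx mulr1 big1 ?addr0 // => j ji.
by rewrite coefZ coefXn eq_sym -[(_ == _)%N]/(j == i) (negbTE ji) mulr0.
Qed.

End PolynomialFunctions.

(** * The equations of the multicone *)

Section Cone.
Variable K : fieldType.

Definition row2 (a b : K) : 'rV[K]_2 := \row_(i < 2) [:: a; b]`_i.
Definition row3 (a b c : K) : 'rV[K]_3 := \row_(i < 3) [:: a; b; c]`_i.

Definition pt (s1 s2 r1 r2 r3 q1 q2 q3 : K) : point K :=
  (row2 s1 s2, row3 r1 r2 r3, row3 q1 q2 q3).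

(** Being boolean, this condition can be tested when a section is extended beyond the multicone. *)
Definition bs_eqns (x : point K) : bool :=
  [&& x.1.1 != 0, x.1.2 != 0, x.2 != 0,
      x.1.1 0 0 * x.1.2 0 0 == x.1.1 0 1 * x.1.2 0 1
    & x.2 0 0 * x.1.2 0 0 - x.2 0 1 * x.1.2 0 1 + x.2 0 ord_max * x.1.2 0 ord_max
        == 0].

Lemma row2E (v : 'rV[K]_2) : v = row2 (v 0 0) (v 0 1).
Proof. by apply/rowP => -[[|[|//]] Hi]; rewrite mxE; congr (v _ _); apply/val_inj. Qed.

Lemma row3E (v : 'rV[K]_3) : v = row3 (v 0 0) (v 0 1) (v 0 ord_max).
Proof. by apply/rowP => i; case: (ord3P i) => ->; rewrite mxE. Qed.

Lemma ptE (x : point K) : x = pt (x.1.1 0 0) (x.1.1 0 1)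
  (x.1.2 0 0) (x.1.2 0 1) (x.1.2 0 ord_max) (x.2 0 0) (x.2 0 1) (x.2 0 ord_max).
Proof. by case: x => [[s r] q]; rewrite /pt -row2E -!row3E. Qed.

Lemma row2_eq0 a b : (row2 a b == 0) = (a == 0) && (b == 0).
Proof.
apply/eqP/andP => [/rowP H|[/eqP-> /eqP->]].
  by have := H 0; have := H 1; rewrite !mxE /= => -> ->.
by apply/rowP => -[[|[|//]] Hi]; rewrite !mxE.
Qed.

Lemma row3_eq0 a b c : (row3 a b c == 0) = [&& a == 0, b == 0 & c == 0].
Proof.
apply/eqP/and3P => [/rowP H|[/eqP-> /eqP-> /eqP->]].
  by have := H 0; have := H 1; have := H ord_max; rewrite !mxE /= => -> -> ->.
by apply/rowP => i; case: (ord3P i) => ->; rewrite !mxE.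
Qed.

Lemma bs_eqns_pt s1 s2 r1 r2 r3 q1 q2 q3 : bs_eqns (pt s1 s2 r1 r2 r3 q1 q2 q3) =
  [&& (s1 != 0) || (s2 != 0), [|| r1 != 0, r2 != 0 | r3 != 0],
      [|| q1 != 0, q2 != 0 | q3 != 0], s1 * r1 == s2 * r2
    & q1 * r1 - q2 * r2 + q3 * r3 == 0].
Proof. by rewrite /bs_eqns /= row2_eq0 !row3_eq0 !negb_and !mxE. Qed.

Lemma unitmx_col0 (p : 'M[K]_3) : p \in unitmx -> ~ (forall i, p i 0 = 0).
Proof.
move=> + p0; rewrite unitmxE unitfE (expand_det_col _ 0) big1 ?eqxx // => i _.
by rewrite p0 mul0r.
Qed.

(** The first column of [N] is a multiple of that of [p1], whence the first equation. The first
    column of [M] is a combination of the first two columns of [N], whose minors form [r_coord N]: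
    the second equation is the vanishing of a determinant with dependent columns. *)
Lemma bs_cone_eqns (x : point K) : bs_cone x -> bs_eqns x.
Proof.
case=> p1 [p2 [p3 [P1p1 P2p2 P1p3 [a [b [c [a0 b0 c0 ->]]]]]]].
have [u1 p1_20 p1_21] := (in_P1P _).1 P1p1.
have [u2 p2_10 p2_20] := (in_P2P _).1 P2p2.
have [u3 p3_20 p3_21] := (in_P1P _).1 P1p3.
pose N := p1 *m p2; pose M := N *m p3.
have uN : N \in unitmx by rewrite unitmx_mul u1.
have uM : M \in unitmx by rewrite unitmx_mul uN.
have N0 i : N i 0 = p1 i 0 * p2 0 0.
  by rewrite mxE sum3 p2_10 p2_20 !mulr0 !addr0.
have M0 i : M i 0 = N i 0 * p3 0 0 + N i 1 * p3 1 0.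
  by rewrite mxE sum3 p3_20 mulr0 addr0.
have [r0 r1 r2] := r_coordE N.
have s0 : s_coord p1 0 0 = p1 0 0 by rewrite mxE; congr (p1 _ _); apply/val_inj.
have s1 : s_coord p1 0 1 = p1 1 0 by rewrite mxE; congr (p1 _ _); apply/val_inj.
apply/and5P; rewrite /= -/N -/M; split.
- rewrite scaler_eq0 negb_or a0 /=; apply/eqP => /rowP s_0.
  have := s_0 0; have := s_0 1; rewrite s0 s1 !mxE => p10 p00.
  by apply: (unitmx_col0 u1) => i; case: (ord3P i) => ->.
- rewrite scaler_eq0 negb_or b0 /=; apply/eqP => r_0; move: uN.
  by rewrite unitmxE unitfE r_coord_det r_0 !mxE !mul0r subr0 addr0 eqxx.
- rewrite scaler_eq0 negb_or c0 /=; apply/eqP => /rowP q_0.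
  by apply: (unitmx_col0 uM) => i; have := q_0 i; rewrite !mxE.
- rewrite [X in X * _ == _]mxE [X in _ * X == _]mxE.
  rewrite [X in _ == X * _]mxE [X in _ == _ * X]mxE s0 s1 r0 r1 !N0 p1_20.
  by apply/eqP; ring.
have E (v : 'rV[K]_3) (e : K) i : (e *: v) 0 i = e * v 0 i by rewrite mxE.
rewrite !E r0 r1 r2 ![q_coord _ _ _]mxE !M0; apply/eqP; ring.
Qed.

Lemma proportional (a b x y : K) : (a != 0) || (b != 0) -> a * y = b * x ->
  exists t, x = t * a /\ y = t * b.
Proof.
have [->|a0 _ E] := eqVneq a 0; rewrite /=.
  move=> b0 /esym; rewrite mul0r => /eqP; rewrite mulf_eq0 (negbTE b0) => /eqP ->.
  by exists (y / b); rewrite mulr0 divfK.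
by exists (x / a); rewrite divfK // mulrAC [x * b]mulrC -E mulrAC divff ?mul1r.
Qed.

Definition P1_mx (a b c d : K) : 'M[K]_3 :=
  \matrix_(i, j) (nth [::] [:: [:: a; c; 0]; [:: b; d; 0]; [:: 0; 0; 1]] i)`_j.

Definition P2_mx (a b c d : K) : 'M[K]_3 :=
  \matrix_(i, j) (nth [::] [:: [:: 1; 0; 0]; [:: 0; a; c]; [:: 0; b; d]] i)`_j.

Lemma in_P1_mx a b c d : a * d - b * c = 1 -> in_P1 (P1_mx a b c d).
Proof.
move=> D; apply/in_P1P; split; rewrite ?mxE //.
have [r0 r1 r2] := r_coordE (P1_mx a b c d).
rewrite unitmxE unitfE; suff -> : \det (P1_mx a b c d) = 1 by exact: oner_neq0.
by rewrite r_coord_det r0 r1 r2 !mxE /= -[RHS]D; ring.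
Qed.

Lemma in_P2_mx a b c d : a * d - b * c = 1 -> in_P2 (P2_mx a b c d).
Proof.
move=> D; apply/in_P2P; split; rewrite ?mxE //.
have [r0 r1 r2] := r_coordE (P2_mx a b c d).
rewrite unitmxE unitfE; suff -> : \det (P2_mx a b c d) = 1 by exact: oner_neq0.
by rewrite r_coord_det r0 r1 r2 !mxE /= -[RHS]D; ring.
Qed.

Lemma unimodular_completion (a b : K) : (a != 0) || (b != 0) ->
  exists c d, a * d - b * c = 1.
Proof.
have [->|a0 _] := eqVneq a 0; last by exists 0, a^-1; field.
by move=> /= b0; exists (- b^-1), 0; field.
Qed.

(** The matrices are read off from the coordinates. The 2 x 2 blocks of [p1], [p2] and [p3] start
    with the columns [(s1, s2)], [(u, t)] and [(e, f)], where [u] is r12, [(r1, r2) = t (s2, s1)],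
    and [e], [f] are the coordinates of [q] in the first two columns of [p1 *m p2]. The second
    equation puts [q] in the span of these columns. *)
Lemma bs_eqns_cone (x : point K) : bs_eqns x -> bs_cone x.
Proof.
rewrite (ptE x); move: (x.1.1 0 0) (x.1.1 0 1) (x.1.2 0 0) (x.1.2 0 1)
  (x.1.2 0 ord_max) (x.2 0 0) (x.2 0 1) (x.2 0 ord_max) => {x}.
move=> s1 s2 r1 r2 u q1 q2 q3; rewrite bs_eqns_pt.
case/and5P => s0 r0 q0 /eqP E1 /eqP E2.
have [t [Dr2 Dr1]] := proportional s0 E1.
have tu : (u != 0) || (t != 0).
  move: r0; rewrite Dr1 Dr2 !mulf_eq0 !negb_or.
  by case: (t != 0); rewrite /= ?orbT ?orbF.
have [f [Df1 Df2]] : exists f, s1 * q2 - s2 * q1 = f * u /\ q3 = f * t.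
  apply: (proportional tu); apply/eqP; rewrite -subr_eq0 -E2 Dr1 Dr2; apply/eqP.
  by ring.
have [c [d Dcd]] := unimodular_completion s0.
have [c' [d' Dcd']] := unimodular_completion tu.
(* Cramer's rule in the basis [(s1, s2)], [(c, d)] of determinant 1. *)
pose e := d * q1 - c * q2.
have Dq1 : q1 = e * s1 + f * (u * c).
  by rewrite /e mulrA -Df1 -[LHS]mul1r -Dcd; ring.
have Dq2 : q2 = e * s2 + f * (u * d).
  by rewrite /e mulrA -Df1 -[LHS]mul1r -Dcd; ring.
have ef : (e != 0) || (f != 0).
  move: q0; rewrite Df2 Dq1 Dq2; have [->|//] := eqVneq e 0.
  by have [->|//] := eqVneq f 0; rewrite !mul0r addr0 eqxx.
have [c'' [d'' Dcd'']] := unimodular_completion ef.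
exists (P1_mx s1 s2 c d), (P2_mx u t c' d'), (P1_mx e f c'' d'').
split; [exact: in_P1_mx|exact: in_P2_mx|exact: in_P1_mx|].
exists 1, 1, 1; split; rewrite ?oner_neq0 // !scale1r /bs_embed /pt /=.
set p1 := P1_mx s1 _ _ _; set N := p1 *m _; set M := N *m _.
have N0 : [/\ N 0 0 = s1, N 1 0 = s2 & N ord_max 0 = 0].
  by split; rewrite mxE sum3 !mxE /=; ring.
have N1 : [/\ N 0 1 = u * c, N 1 1 = u * d & N ord_max 1 = t].
  by split; rewrite mxE sum3 !mxE /=; ring.
case: N0 N1 => N00 N10 N20 [N01 N11 N21].
have [R0 R1 R2] := r_coordE N.
congr (_, _, _); symmetry.
- by rewrite (row2E (s_coord _)); congr row2; rewrite !mxE.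
- rewrite (row3E (r_coord _)) R0 R1 R2 N00 N10 N20 N01 N11 N21 Dr1 Dr2.
  congr row3; [ring|ring|].
  by rewrite -[RHS]mul1r -Dcd; ring.
rewrite (row3E (q_coord _)); congr row3; rewrite !mxE sum3 ?N00 ?N10 ?N20 ?N01 ?N11 ?N21 !mxE /=.
- by rewrite [RHS]Dq1; ring.
- by rewrite [RHS]Dq2; ring.
- by rewrite Df2; ring.
Qed.

End Cone.

(** * Regular sections along polynomial curves *)

Section RegularSections.
Variable K : numClosedFieldType.

Lemma prod8 (F : 'I_(2 + 3 + 3) -> K) : \prod_i F i =
  (\prod_(i < 2) F (lshift 3 (lshift 3 i)) * \prod_(i < 3) F (lshift 3 (rshift 2 i)))
  * \prod_(i < 3) F (rshift (2 + 3) i).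
Proof. by rewrite !big_split_ord. Qed.

Lemma coord_pt (s1 s2 r1 r2 r3 q1 q2 q3 : K) i :
  let x := pt s1 s2 r1 r2 r3 q1 q2 q3 in
  row_mx (row_mx x.1.1 x.1.2) x.2 0 i = [:: s1; s2; r1; r2; r3; q1; q2; q3]`_i.
Proof.
rewrite /=; case: (split_ordP i) => [j ->|j ->]; last first.
  by rewrite row_mxEr mxE; case: j => -[|[|[]]].
by rewrite row_mxEl; case: (split_ordP j) => k ->; rewrite ?row_mxEl ?row_mxEr mxE;
  case: k => -[|[|[]]].
Qed.

Lemma eval_at_scale (a b c : nat) (f : coord_poly K) (u v w : K) (x : point K) :
  multihomog a b c f ->
  eval_at f (u *: x.1.1, v *: x.1.2, w *: x.2)
    = u ^+ a * v ^+ b * w ^+ c * eval_at f x.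
Proof.
move=> Hf; rewrite /eval_at !mevalE mulr_sumr; apply: eq_big_seq => m mf.
have [Ea Eb Ec] := Hf m mf; rewrite mulrCA; congr (_ * _).
have scale_prod (k : nat) (t : K) (z : 'rV_k) (h : 'I_k -> nat) :
    \prod_(i < k) (t *: z) 0 i ^+ h i
      = t ^+ (\sum_(i < k) h i)%N * \prod_(i < k) z 0 i ^+ h i.
  rewrite -prodrXr -big_split; apply: eq_bigr => i _.
  by rewrite mxE exprMn.
rewrite !prod8 /=; under eq_bigr do rewrite 2!row_mxEl.
under [X in _ * X * _ = _]eq_bigr do rewrite row_mxEl row_mxEr.
under [X in _ * _ * X = _]eq_bigr do rewrite row_mxEr.
rewrite !scale_prod Ea Eb Ec.
under [X in _ = _ * (X * _ * _)]eq_bigr do rewrite 2!row_mxEl.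
under [X in _ = _ * (_ * X * _)]eq_bigr do rewrite row_mxEl row_mxEr.
under [X in _ = _ * (_ * _ * X)]eq_bigr do rewrite row_mxEr.
by rewrite [RHS]mulrACA [X in _ = X * _]mulrACA.
Qed.

Definition ptcurve (p1 p2 p3 p4 p5 p6 p7 p8 : {poly K}) (z : K) : point K :=
  pt p1.[z] p2.[z] p3.[z] p4.[z] p5.[z] p6.[z] p7.[z] p8.[z].

Lemma eval_at_curve (f : coord_poly K) p1 p2 p3 p4 p5 p6 p7 p8 :
  exists h : {poly K}, forall z,
    eval_at f (ptcurve p1 p2 p3 p4 p5 p6 p7 p8 z) = h.[z].
Proof.
exists (\sum_(m <- msupp f)
  f@_m *: \prod_(i < 2 + 3 + 3) [:: p1; p2; p3; p4; p5; p6; p7; p8]`_i ^+ m i) => z.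
rewrite /eval_at mevalE horner_sum; apply: eq_bigr => m _.
rewrite hornerZ horner_prod; congr (_ * _); apply: eq_bigr => i _.
rewrite coord_pt horner_exp; congr (_ ^+ _).
by case: i => -[|[|[|[|[|[|[|[|//]]]]]]]].
Qed.

(** The condition of [is_section] for a function of all points, so that a section can be evaluated
    at explicit coordinates without carrying a proof of membership. *)
Definition regular (n : nat) (S : point K -> K) := forall x, bs_eqns x ->
  exists (a b c : nat) (f g : coord_poly K),
    [/\ multihomog (a + n) (b + n) (c + n) f, multihomog a b c g,
        eval_at g x != 0
      & forall y, bs_eqns y -> eval_at g y != 0 ->
          S y = eval_at f y / eval_at g y].

Lemma section_regular n (sigma : {x : point K | bs_cone x} -> K) :
  is_section n n n sigma ->
  exists2 S, regular n S & forall y, sigma y = S (sval y).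
Proof.
move=> Hs.
(* The local formula sees only the underlying point, so [sigma] does not depend on the proof of
   membership. *)
have irr y y' : sval y = sval y' -> sigma y = sigma y'.
  have [a [b [c [f [g [_ _ gy H]]]]]] := Hs y => E.
  by rewrite (H y) // (H y') -E.
exists (fun x => match bs_eqns x =P true with
  | ReflectT h => sigma (exist _ x (bs_eqns_cone h)) | ReflectF _ => 0 end).
  move=> x xX.
  have [a [b [c [f [g [Hf Hg gx H]]]]]] := Hs (exist _ x (bs_eqns_cone xX)).
  exists a, b, c, f, g; split=> // y yX gy; case: eqP => // yX'.
  by rewrite H.
move=> y; case: eqP => [h|]; last by case; apply: bs_cone_eqns; apply: svalP.
exact: irr.
Qed.

Section Regular.
Variables (n : nat) (S : point K -> K).
Hypothesis regS : regular n S.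

Lemma bs_eqns_scale (u v w : K) x : u != 0 -> v != 0 -> w != 0 ->
  bs_eqns x -> bs_eqns (u *: x.1.1, v *: x.1.2, w *: x.2).
Proof.
move=> u0 v0 w0 /and5P[s0 r0 q0 /eqP e1 /eqP e2].
apply/and5P; rewrite /= !scaler_eq0 !negb_or u0 v0 w0; split=> //; rewrite !mxE.
  by rewrite mulrACA e1 mulrACA.
have E (a b c d e f : K) : w * a * (v * b) - w * c * (v * d) + w * e * (v * f)
    = w * v * (a * b - c * d + e * f) by ring.
by rewrite E e2 mulr0.
Qed.

Lemma regular_scale (u v w : K) x : u != 0 -> v != 0 -> w != 0 -> bs_eqns x ->
  S (u *: x.1.1, v *: x.1.2, w *: x.2) = (u * v * w) ^+ n * S x.
Proof.
move=> u0 v0 w0 xX; have [a [b [c [f [g [Hf Hg gx H]]]]]] := regS xX.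
rewrite (H x xX gx) H ?bs_eqns_scale //; last first.
  by rewrite (eval_at_scale _ _ _ _ Hg) !mulf_neq0 // expf_neq0.
rewrite (eval_at_scale _ _ _ _ Hf) (eval_at_scale _ _ _ _ Hg) !exprD !exprMn.
by field; rewrite gx !expf_neq0.
Qed.

Lemma regular_scale_pt (u v w s1 s2 r1 r2 r3 q1 q2 q3 : K) :
  u != 0 -> v != 0 -> w != 0 -> bs_eqns (pt s1 s2 r1 r2 r3 q1 q2 q3) ->
  S (pt (u * s1) (u * s2) (v * r1) (v * r2) (v * r3) (w * q1) (w * q2) (w * q3))
    = (u * v * w) ^+ n * S (pt s1 s2 r1 r2 r3 q1 q2 q3).
Proof.
move=> u0 v0 w0 xX; rewrite -regular_scale //; congr (S (_, _, _)) => /=.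
- by apply/rowP => -[[|[]]] // Hi; rewrite !mxE.
- by apply/rowP => -[[|[|[]]]] // Hi; rewrite !mxE.
- by apply/rowP => -[[|[|[]]]] // Hi; rewrite !mxE.
Qed.

(** Along the curve the local fractions become fractions of polynomials in the parameter, to which
    [locally_rational_poly] applies. The later constraints on sections combine this with
    homogeneity. *)
Lemma regular_curve p1 p2 p3 p4 p5 p6 p7 p8 :
  (forall z, bs_eqns (ptcurve p1 p2 p3 p4 p5 p6 p7 p8 z)) ->
  exists h : {poly K}, forall z, S (ptcurve p1 p2 p3 p4 p5 p6 p7 p8 z) = h.[z].
Proof.
move=> HX; apply: locally_rational_poly => z0.
have [a [b [c [f [g [_ _ gx H]]]]]] := regS (HX z0).
have [F HF] := eval_at_curve f p1 p2 p3 p4 p5 p6 p7 p8.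
have [G HG] := eval_at_curve g p1 p2 p3 p4 p5 p6 p7 p8.
exists F, G; split=> [|z]; rewrite -HG // => Gz.
by rewrite H // HF.
Qed.

End Regular.
End RegularSections.

(** * Sections on the affine chart *)

Section Chart.
Variable K : numClosedFieldType.

(* The locus [s1 = r12 = q1 = 1], with [t = r13]. *)
Definition chart (x t y : K) : point K :=
  pt 1 x (t * x) t 1 1 y (t * (y - x)).

Lemma chart_eqns x t y : bs_eqns (chart x t y).
Proof.
rewrite bs_eqns_pt oner_neq0 !orbT /=; apply/andP.
by split; apply/eqP; ring.
Qed.

Variables (n : nat) (S : point K -> K).
Hypothesis regS : regular n S.

Let H x t y := S (chart x t y).

Lemma regular_curve_eq (phi : K -> point K) p1 p2 p3 p4 p5 p6 p7 p8 :
  (forall z, bs_eqns (phi z)) ->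
  (forall z, phi z = ptcurve p1 p2 p3 p4 p5 p6 p7 p8 z) ->
  exists h : {poly K}, forall z, S (phi z) = h.[z].
Proof.
move=> HX E; have [z|h Dh] := @regular_curve _ _ _ regS p1 p2 p3 p4 p5 p6 p7 p8.
  by rewrite -E.
by exists h => z; rewrite E.
Qed.

Lemma chart_scale (u v w x t y : K) p : u != 0 -> v != 0 -> w != 0 ->
  p = pt (u * 1) (u * x) (v * (t * x)) (v * t) (v * 1) (w * 1) (w * y)
         (w * (t * (y - x))) ->
  S p = (u * v * w) ^+ n * H x t y.
Proof. by move=> u0 v0 w0 ->; rewrite (regular_scale_pt regS) // chart_eqns. Qed.

Lemma chart_poly_y x t : exists2 p : {poly K}, (size p <= n.+1)%N &
  forall y, H x t y = p.[y].
Proof.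
have [||p Dp] := @regular_curve_eq (chart x t) 1%:P x%:P (t * x)%:P t%:P 1%:P 1%:P 'X
  (t%:P * ('X - x%:P)).
- exact: chart_eqns.
- by move=> z; rewrite /ptcurve !hornerE.
exists p => //.
(* The same line near q1 = 0, with z = 1 / y; scaling [q] by z contributes the factor z ^ n. *)
have [||q Dq] := @regular_curve_eq (fun z => pt 1 x (t * x) t 1 z 1 (t * (1 - x * z)))
  1%:P x%:P (t * x)%:P t%:P 1%:P 'X 1%:P (t%:P * (1 - x%:P * 'X)).
- move=> z; rewrite bs_eqns_pt oner_neq0 !orbT /=; apply/andP.
  by split; apply/eqP; ring.
- by move=> z; rewrite /ptcurve !hornerE.
apply: (@size_poly_inv _ n p q) => z z0; rewrite -Dq -Dp.
rewrite (@chart_scale 1 1 z x t z^-1) ?oner_neq0 ?mul1r //.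
by congr pt; field.
Qed.

(** At t = infinity [r] has to be scaled by 1 / t, and so has [q] when y differs from x, since q3
    grows with t: hence the degree 2n. When y = x, q3 is zero and such a scaling would make [q]
    vanish at infinity, so only [r] is scaled. *)
Lemma chart_poly_t x y : exists2 p : {poly K}, (size p <= (n + n).+1)%N &
  forall t, H x t y = p.[t].
Proof.
have [||p Dp] := @regular_curve_eq (fun t => chart x t y) 1%:P x%:P ('X * x%:P) 'X 1%:P
  1%:P y%:P ('X * (y - x)%:P).
- by move=> t; apply: chart_eqns.
- by move=> z; rewrite /ptcurve !hornerE.
exists p => //; have [Exy|yx] := eqVneq y x.
  have [||q Dq] := @regular_curve_eq (fun z => pt 1 x x 1 z 1 x 0)
    1%:P x%:P x%:P 1%:P 'X 1%:P x%:P 0%:P.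
  - move=> z; rewrite bs_eqns_pt oner_neq0 !orbT /=; apply/andP.
    by split; apply/eqP; ring.
  - by move=> z; rewrite /ptcurve !hornerE.
  rewrite (leq_trans (n := n.+1)) ?ltnS ?leq_addr //.
  apply: (@size_poly_inv _ n p q) => z z0; rewrite -Dq -Dp.
  rewrite (@chart_scale 1 z 1 x z^-1 y) ?oner_neq0 ?mul1r ?mulr1 //.
  by rewrite Exy; congr pt; field.
have [||q Dq] := @regular_curve_eq (fun z => pt 1 x x 1 z z (z * y) (y - x))
  1%:P x%:P x%:P 1%:P 'X 'X ('X * y%:P) (y - x)%:P.
- move=> z; rewrite bs_eqns_pt oner_neq0 subr_eq0 yx !orbT /=; apply/andP.
  by split; apply/eqP; ring.
- by move=> z; rewrite /ptcurve !hornerE.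
apply: (@size_poly_inv _ (n + n) p q) => z z0; rewrite -Dq -Dp.
rewrite (@chart_scale 1 z z x z^-1 y) ?oner_neq0 // ?mul1r ?exprMn ?exprD //.
by congr pt; field.
Qed.

Lemma chart_poly_x t y : exists p : {poly K}, forall x, H x t y = p.[x].
Proof.
apply: (@regular_curve_eq (fun x => chart x t y) 1%:P 'X (t%:P * 'X) t%:P 1%:P 1%:P
  y%:P (t%:P * (y%:P - 'X))) => [x|x]; first exact: chart_eqns.
by rewrite /ptcurve !hornerE.
Qed.

(* The curve crosses the divisor [s1 = 0] at [z = 0]. *)
Lemma chart_inv_x t y : exists q : {poly K}, forall z, z != 0 ->
  q.[z] = z ^+ n * H z^-1 (z * t) y.
Proof.
have [||q Dq] := @regular_curve_eq (fun z => pt z 1 t (t * z) 1 1 y (t * (y * z - 1)))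
  'X 1%:P t%:P (t%:P * 'X) 1%:P 1%:P y%:P (t%:P * (y%:P * 'X - 1)).
- move=> z; rewrite bs_eqns_pt oner_neq0 !orbT /=; apply/andP.
  by split; apply/eqP; ring.
- by move=> z; rewrite /ptcurve !hornerE.
exists q => z z0; rewrite -Dq.
rewrite (@chart_scale z 1 1 z^-1 (z * t) y) ?oner_neq0 ?mulr1 //.
by congr pt; field.
Qed.

(* The curve crosses the divisor [r12 = 0] at [z = 0]. *)
Lemma chart_boundary x w : exists q : {poly K}, forall z, z != 0 ->
  q.[z] = z ^+ n * H x z^-1 (x + w * z).
Proof.
have [||q Dq] := @regular_curve_eq (fun z => pt 1 x x 1 z 1 (x + w * z) w)
  1%:P x%:P x%:P 1%:P 'X 1%:P (x%:P + w%:P * 'X) w%:P.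
- move=> z; rewrite bs_eqns_pt oner_neq0 !orbT /=; apply/andP.
  by split; apply/eqP; ring.
- by move=> z; rewrite /ptcurve !hornerE.
exists q => z z0; rewrite -Dq.
rewrite (@chart_scale 1 z 1 x z^-1 (x + w * z)) ?oner_neq0 ?mul1r ?mulr1 //.
by congr pt; field.
Qed.

End Chart.

(** * Expansion of a section in powers of t *)

Section Expand.
Variable K : numClosedFieldType.

Variables (n : nat) (S : point K -> K).
Hypothesis regS : regular n S.

Let H x t y := S (chart x t y).

Lemma chart_expand_t : exists A : 'I_(n + n).+1 -> {poly {poly K}},
  (forall i, (size (A i) <= n.+1)%N /\ (sizeY (A i) <= (n + i).+1)%N) /\
  forall x t y, H x t y = \sum_i (A i).[y%:P].[x] * t ^+ i.
Proof.
have [M DM] := vandermonde_inv K (n + n).+1.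
(* The coefficient of [t ^+ i], recovered from the values at t = 0, ..., 2n. *)
pose a (i : 'I_(n + n).+1) x y := \sum_(j < (n + n).+1) H x j%:R y * M j i.
have Ha x t y : H x t y = \sum_i a i x y * t ^+ i.
  have [p sp Dp] := chart_poly_t regS x y.
  rewrite /H Dp (horner_coef_wide t sp); apply: eq_bigr => i _; congr (_ * _).
  rewrite -[LHS](DM (fun l => p`_l)); apply: eq_bigr => j _; congr (_ * _).
  by rewrite /H Dp (horner_coef_wide _ sp).
have ax (i : 'I_(n + n).+1) y : exists2 p : {poly K}, (size p <= (n + i).+1)%N
  & forall x, a i x y = p.[x].
  have [P DP] := fin_all_exists (fun j : 'I_(n + n).+1 => chart_poly_x regS j%:R y).
  have [Q DQ] := fin_all_exists (fun j : 'I_(n + n).+1 => chart_inv_x regS j%:R y).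
  pose p := \sum_j M j i *: P j; pose q := \sum_j M j i *: Q j.
  have Dp x : a i x y = p.[x].
    rewrite horner_sum; apply: eq_bigr => j _.
    by rewrite hornerZ -DP mulrC.
  exists p => //; apply: (@size_poly_inv _ (n + i) p q) => z z0.
  (* These are the coefficients in t of [z ^+ n * H z^-1 (z * t) y], which is a polynomial in z for
     each t. Hence so are they, and this bounds the degree of [a i] in x by n + i. *)
  pose c (l : 'I_(n + n).+1) := z ^+ (n + l) * a l z^-1 y.
  rewrite -Dp -[RHS](DM c i) horner_sum; apply: eq_bigr => j _.
  rewrite hornerZ (DQ j z z0) -/(H _ _ _) Ha mulrC mulr_sumr; congr (_ * _).
  by apply: eq_bigr => l _; rewrite /c exprMn exprD; ring.
have ay (i : 'I_(n + n).+1) x : exists2 p : {poly K}, (size p <= n.+1)%N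
  & forall y, a i x y = p.[y].
  have [P sP DP] := fin_all_exists2
    (fun j : 'I_(n + n).+1 => chart_poly_y regS x j%:R).
  exists (\sum_j M j i *: P j) => [|y].
    rewrite (leq_trans (size_sum _ _ _)) //; apply/bigmax_leqP => j _.
    by rewrite (leq_trans (size_scale_leq _ _)).
  by rewrite horner_sum; apply: eq_bigr => j _; rewrite hornerZ -DP mulrC.
have [A DA] := fin_all_exists (fun i => bivariate_interp (ax i) (ay i)).
exists A; split=> [i|x t y]; first by case: (DA i).
by rewrite Ha; apply: eq_bigr => i _; case: (DA i) => _ _ ->.
Qed.

(** Put t = 1 / z and y = x + w z in z ^ n H. A term t ^ j (y - x) ^ m becomes w ^ m z ^ (n - j +
    m). The result has no pole at z = 0, so negative powers of z cancel for every w; the powers of w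
    separate the values of m, and then the exponent of z determines j. *)
Lemma chart_diagonal (A : 'I_(n + n).+1 -> {poly {poly K}}) :
  (forall i, (size (A i) <= n.+1)%N) ->
  (forall x t y, H x t y = \sum_i (A i).[y%:P].[x] * t ^+ i) ->
  forall (i : 'I_(n + n).+1) k, (k < i - n)%N -> (A i \Po ('X + 'X%:P))`_k = 0.
Proof.
move=> sA HA i k lt_k; apply: poly_fun0 => x.
pose b (j : 'I_(n + n).+1) k := ((A j \Po ('X + 'X%:P))`_k).[x].
have Ab j v : (A j).[(x + v)%:P].[x] = \sum_(k < n.+1) b j k * v ^+ k.
  have sAj : (size (A j \Po ('X + 'X%:P)) <= n.+1)%N.
    by rewrite size_comp_poly2 // -['X%:P]opprK -polyCN size_XsubC.
  transitivity ((A j \Po ('X + 'X%:P)).[v%:P].[x]).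
    by rewrite horner_comp [RHS]horner_eval_inner !hornerE addrC.
  rewrite (horner_coef_wide _ sAj) horner_sum; apply: eq_bigr => l _.
  by rewrite hornerM -polyC_exp hornerC.
(* The exponent of z for the term in question after one more multiplication by z ^ n, which makes
   all exponents natural. It is below n exactly because k < i - n. *)
pose l := (n + n + k - i)%N.
have key w : \sum_(m < n.+1) (\sum_(j < (n + n).+1 | (n + n - j + m == l)%N) b j m) * w ^+ m
    = 0.
  have [q Dq] := chart_boundary regS x w.
  have E : 'X^n * q = \sum_j \sum_(m < n.+1) (b j m * w ^+ m) *: 'X^(n + n - j + m).
    apply: (@poly_fun_eq_ae _ _ _ 'X); first by rewrite polyX_eq0.
    move=> z; rewrite hornerX => z0; rewrite hornerM hornerXn Dq // -/(H _ _ _) HA.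
    rewrite mulrA -exprD mulr_sumr horner_sum; apply: eq_bigr => j _.
    rewrite Ab mulr_suml mulr_sumr horner_sum; apply: eq_bigr => m _.
    rewrite hornerZ hornerXn exprMn exprVn.
    have jn : (j <= n + n)%N by rewrite -ltnS.
    have -> : z ^+ (n + n) = z ^+ (n + n - j) * z ^+ j by rewrite -exprD subnK.
    by rewrite exprD; field; rewrite expf_neq0.
  have := congr1 (fun p : {poly K} => p`_l) E; rewrite coefXnM.
  have -> : (l < n)%N by rewrite /l; have := ltn_ord i; lia.
  move/esym; rewrite coef_sum => E0; rewrite -[RHS]E0.
  under [RHS]eq_bigr do rewrite coef_sum.
  rewrite exchange_big /=; apply: eq_bigr => m _; rewrite mulr_suml big_mkcond /=.
  apply: eq_bigr => j _; rewrite coefZ coefXn eq_sym.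
  by case: eqP; rewrite ?mulr1 ?mulr0.
have kn : (k < n.+1)%N by have := ltn_ord i; lia.
have := @poly_coefs0 _ n.+1
  (fun m => \sum_(j < (n + n).+1 | (n + n - j + m == l)%N) b j m) 1 (oner_neq0 _)
  (fun w _ => key w) (Ordinal kn).
rewrite /= (bigD1 i) /=; last by rewrite /l; have := ltn_ord i; lia.
rewrite big1 ?addr0 // => j /andP[/eqP Ej ji].
by case/eqP: ji; apply/val_inj => /=; have := ltn_ord i; have := ltn_ord j; lia.
Qed.

(** The truncated [i - n] is the order of vanishing along y = x that [chart_diagonal] forces; it is
    0 for i at most n. *)
Definition basis_fun (i a c : nat) (x t y : K) : K :=
  x ^+ a * t ^+ i * (y - x) ^+ (i - n) * y ^+ c.

Lemma chart_expand : exists C : nat -> nat -> nat -> K, forall x t y,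
  H x t y = \sum_(i < (n + n).+1) \sum_(a < (n + i).+1 - (i - n))
              \sum_(c < n.+1 - (i - n)) C i a c * basis_fun i a c x t y.
Proof.
have [A [sA HA]] := chart_expand_t.
have diag := chart_diagonal (fun i => (sA i).1) HA.
have [B DB] := fin_all_exists (fun i => dvd_diagonal (diag i)).
(* The outer variable is y, so its exponent [c] is taken first. *)
exists (fun i a c => (B (inord i))`_c`_a) => x t y.
rewrite HA; apply: eq_bigr => i _; rewrite inord_val.
have [sB sYB ->] := DB i; have [sAi sYAi] := sA i.
have sB' : (size (B i) <= n.+1 - (i - n))%N by rewrite (leq_trans sB) // leq_sub2r.
have sYB' : (sizeY (B i) <= (n + i).+1 - (i - n))%N.
  by rewrite (leq_trans sYB) // leq_sub2r.
rewrite exchange_big /= !(hornerM, horner_exp) hornerXsubC !(hornerE, horner_exp).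
rewrite (horner_coef_wide _ sB') horner_sum mulr_sumr mulr_suml.
apply: eq_bigr => c _; rewrite hornerM -polyC_exp hornerC.
rewrite (horner_coef_wide _ (leq_trans (max_size_coefXY _ _) sYB')).
rewrite mulr_suml mulr_sumr mulr_suml; apply: eq_bigr => a _.
by rewrite /basis_fun; ring.
Qed.

End Expand.

(** * Regular functions are determined by their values on the chart *)

Section Density.
Variable K : numClosedFieldType.
Variables (n : nat) (S1 S2 : point K -> K).
Hypotheses (reg1 : regular n S1) (reg2 : regular n S2).

Lemma regular_eq_curve (phi : K -> point K) p1 p2 p3 p4 p5 p6 p7 p8 :
  (forall z, bs_eqns (phi z)) ->
  (forall z, phi z = ptcurve p1 p2 p3 p4 p5 p6 p7 p8 z) ->
  (forall z, z != 0 -> S1 (phi z) = S2 (phi z)) -> S1 (phi 0) = S2 (phi 0).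
Proof.
move=> HX Ephi E.
have [h1 D1] := regular_curve_eq reg1 HX Ephi.
have [h2 D2] := regular_curve_eq reg2 HX Ephi.
rewrite D1 D2 (@poly_fun_eq_ae _ h1 h2 'X) ?polyX_eq0 // => z.
by rewrite hornerX -D1 -D2; apply: E.
Qed.

Hypothesis eq_chart : forall x t y, S1 (chart x t y) = S2 (chart x t y).

Lemma regular_eq_open s1 s2 r1 r2 r3 q1 q2 q3 :
  s1 != 0 -> r3 != 0 -> q1 != 0 ->
  bs_eqns (pt s1 s2 r1 r2 r3 q1 q2 q3) ->
  S1 (pt s1 s2 r1 r2 r3 q1 q2 q3) = S2 (pt s1 s2 r1 r2 r3 q1 q2 q3).
Proof.
move=> s10 r30 q10; rewrite bs_eqns_pt => /and5P[_ _ _ /eqP e1 /eqP e2].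
pose x := s2 / s1; pose t := r2 / r3; pose y := q2 / q1.
have Dr1 : r1 = r3 * (t * x).
  by apply: (mulfI s10); rewrite e1 /t /x; field; rewrite s10.
have Dq3 : q3 = q1 * (t * (y - x)).
  apply: (mulIf r30); apply/eqP; rewrite -subr_eq0 -e2 Dr1; apply/eqP.
  by rewrite /t /x /y; field; rewrite s10 r30.
have E : pt s1 s2 r1 r2 r3 q1 q2 q3 = pt (s1 * 1) (s1 * x) (r3 * (t * x)) (r3 * t)
    (r3 * 1) (q1 * 1) (q1 * y) (q1 * (t * (y - x))).
  by rewrite -Dr1 -Dq3 !mulr1 /x /t /y; congr pt; field.
by rewrite (chart_scale reg1 s10 r30 q10 E) (chart_scale reg2 s10 r30 q10 E) eq_chart.
Qed.

Lemma regular_eq_s1_r3 s1 s2 r1 r2 r3 q1 q2 q3 : s1 != 0 -> r3 != 0 ->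
  bs_eqns (pt s1 s2 r1 r2 r3 q1 q2 q3) ->
  S1 (pt s1 s2 r1 r2 r3 q1 q2 q3) = S2 (pt s1 s2 r1 r2 r3 q1 q2 q3).
Proof.
move=> s10 r30 X; have [q10|q10] := eqVneq q1 0; last exact: regular_eq_open.
move: X; rewrite bs_eqns_pt => /and5P[_ r0 q0 /eqP e1 /eqP e2].
(* By the first equation, moving [q] along [(s1, s2, 0)] preserves the second. *)
pose phi z := pt s1 s2 r1 r2 r3 (z * s1) (q2 + z * s2) q3.
have phiX z : bs_eqns (phi z).
  rewrite bs_eqns_pt s10 r0 e1 eqxx mulf_eq0 negb_or s10 andbT /=; apply/andP; split.
    have [->|//] := eqVneq z 0; move: q0.
    by rewrite q10 eqxx mul0r addr0.
  rewrite -mulrA e1 -[X in _ == X]e2 q10; apply/eqP; ring.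
have -> : pt s1 s2 r1 r2 r3 q1 q2 q3 = phi 0 by rewrite /phi q10 !mul0r addr0.
apply: (@regular_eq_curve _ s1%:P s2%:P r1%:P r2%:P r3%:P ('X * s1%:P)
  (q2%:P + 'X * s2%:P) q3%:P phiX) => [z|z z0].
  by rewrite /phi /ptcurve !(hornerD, hornerM, hornerX, hornerC).
exact: (regular_eq_open s10 r30 (mulf_neq0 z0 s10) (phiX z)).
Qed.

Lemma regular_eq_s1 s1 s2 r1 r2 r3 q1 q2 q3 : s1 != 0 ->
  bs_eqns (pt s1 s2 r1 r2 r3 q1 q2 q3) ->
  S1 (pt s1 s2 r1 r2 r3 q1 q2 q3) = S2 (pt s1 s2 r1 r2 r3 q1 q2 q3).
Proof.
move=> s10 X; have [r30|r30] := eqVneq r3 0; last exact: regular_eq_s1_r3.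
move: X; rewrite bs_eqns_pt => /and5P[_ r0 q0 /eqP e1 /eqP e2].
have r20 : r2 != 0.
  apply: contraTneq r0 => r20; rewrite r30 r20 !eqxx /= !orbF negbK.
  by move/eqP: e1; rewrite r20 mulr0 mulf_eq0 (negbTE s10).
(* The change of q2 offsets the new term z q3 in the second equation. *)
pose phi z := pt s1 s2 r1 r2 z q1 (q2 + z * (q3 / r2)) q3.
have phiX z : bs_eqns (phi z).
  rewrite bs_eqns_pt s10 r20 orbT e1 eqxx /=; apply/andP; split.
    have [q30|] := eqVneq q3 0; last by rewrite !orbT.
    by move: q0; rewrite q30 mul0r mulr0 addr0 eqxx.
  by rewrite -[X in _ == X]e2 r30; apply/eqP; field.
have -> : pt s1 s2 r1 r2 r3 q1 q2 q3 = phi 0 by rewrite /phi r30 !mul0r addr0.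
apply: (@regular_eq_curve _ s1%:P s2%:P r1%:P r2%:P 'X q1%:P
  (q2%:P + 'X * (q3 / r2)%:P) q3%:P phiX) => [z|z z0].
  by rewrite /phi /ptcurve !(hornerD, hornerM, hornerX, hornerC).
exact: (regular_eq_s1_r3 s10 z0 (phiX z)).
Qed.

Lemma regular_eq x : bs_eqns x -> S1 x = S2 x.
Proof.
rewrite (ptE x); move: (x.1.1 0 0) (x.1.1 0 1) (x.1.2 0 0) (x.1.2 0 1)
  (x.1.2 0 ord_max) (x.2 0 0) (x.2 0 1) (x.2 0 ord_max) => {x}.
move=> s1 s2 r1 r2 r3 q1 q2 q3 X.
have [s10|s10] := eqVneq s1 0; last exact: regular_eq_s1.
move: X; rewrite bs_eqns_pt => /and5P[s0 r0 q0 /eqP e1 /eqP e2].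
have s20 : s2 != 0 by move: s0; rewrite s10 eqxx.
have r20 : r2 = 0.
  by move/esym/eqP: e1; rewrite s10 mul0r mulf_eq0 (negbTE s20) => /eqP.
(* r2 follows s1 by the first equation, and q1 moves so that the terms in r1 and r2 of the second
   equation offset each other. *)
pose phi z := pt z s2 r1 (z * (r1 / s2)) r3 (q1 + z * (q2 / s2)) q2 q3.
have phiX z : bs_eqns (phi z).
  rewrite bs_eqns_pt s20 orbT /=; apply/and4P; split.
  - by move: r0; rewrite r20 eqxx /= => /orP[->|->]; rewrite ?orbT.
  - have [q20|] := eqVneq q2 0; last by rewrite !orbT.
    by move: q0; rewrite q20 mul0r mulr0 addr0 eqxx.
  - by apply/eqP; field.
  - by rewrite -[X in _ == X]e2 r20; apply/eqP; field.
have -> : pt s1 s2 r1 r2 r3 q1 q2 q3 = phi 0.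
  by rewrite /phi s10 r20 !mul0r addr0.
apply: (@regular_eq_curve _ 'X s2%:P r1%:P ('X * (r1 / s2)%:P) r3%:P
  (q1%:P + 'X * (q2 / s2)%:P) q2%:P q3%:P phiX) => [z|z z0].
  by rewrite /phi /ptcurve !(hornerD, hornerM, hornerX, hornerC).
exact: (regular_eq_s1 z0 (phiX z)).
Qed.

End Density.

(** * A monomial basis of the space of sections *)

Section HasDim.
Variable K : fieldType.

Lemma has_dim_fin (T : Type) (V : (T -> K) -> Prop) (J : finType) (P : pred J)
  (e : J -> T -> K) :
  (forall c : J -> K, (forall x, \sum_(j | P j) c j * e j x = 0) ->
     forall j, P j -> c j = 0) ->
  (forall sigma, V sigma <->
     exists c : J -> K, forall x, sigma x = \sum_(j | P j) c j * e j x) ->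
  has_dim V #|P|.
Proof.
move=> indep span; exists (fun l => e (enum_val l)).
have sumE (c : 'I_#|P| -> K) : exists2 c' : J -> K, forall l, c' (enum_val l) = c l &
    forall x, \sum_(l < #|P|) c l * e (enum_val l) x = \sum_(j | P j) c' j * e j x.
  (* Extension of [c] by zero: the sum has one term if [P j] holds and none otherwise. *)
  pose c' j := \sum_(l < #|P| | enum_val l == j) c l.
  have Dc' l : c' (enum_val l) = c l.
    by rewrite /c' (big_pred1 l) // => m; rewrite /= (inj_eq enum_val_inj).
  exists c' => // x; rewrite [RHS](big_enum_val (A := P)).
  by apply: eq_bigr => l _; rewrite Dc'.
split=> [c c0 l|sigma].
  have [c' <- Dc] := sumE c; apply: indep => [x|]; first by rewrite -Dc.
  exact: (enum_valP l).
rewrite span; split=> [[c Dc]|[c Dc]].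
  by exists (fun l => c (enum_val l)) => x; rewrite Dc [LHS](big_enum_val (A := P)).
by have [c' _ Dc'] := sumE c; exists c' => x; rewrite Dc Dc'.
Qed.

(** The matrix of coordinates of the first basis in the second has independent rows, since a vector
    in its left kernel gives a linear relation in the first basis. *)
Lemma has_dim_leq (T : Type) (V : (T -> K) -> Prop) d d' :
  has_dim V d -> has_dim V d' -> (d <= d')%N.
Proof.
move=> [e [ind span]] [e' [_ span']].
have eV i : V (e i).
  apply/span; exists (fun j => (j == i)%:R) => x; rewrite (bigD1 i) //= eqxx mul1r.
  by rewrite big1 ?addr0 // => j /negbTE ->; rewrite mul0r.
have [a Da] := fin_all_exists (fun i => (span' (e i)).1 (eV i)).
pose A : 'M[K]_(d, d') := \matrix_(i, j) a i j.
suff : row_free A by move/eqP <-; apply: rank_leq_col.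
rewrite -kermx_eq0; apply/rowV0P => v /sub_kermxP vA; apply/rowP => i; rewrite mxE.
apply: (ind (fun i => v 0 i)) => x.
under eq_bigr do rewrite Da mulr_sumr.
rewrite exchange_big big1 // => j _.
have := congr1 (fun w : 'rV_d' => w 0 j) vA; rewrite !mxE => E.
transitivity ((\sum_k v 0 k * A k j) * e' j x); last by rewrite E mul0r.
by rewrite mulr_suml; apply: eq_bigr => k _; rewrite mxE mulrA.
Qed.

Lemma has_dim_uniq (T : Type) (V : (T -> K) -> Prop) d d' :
  has_dim V d -> has_dim V d' -> d = d'.
Proof.
move=> h h'; apply/eqP; rewrite eqn_leq.
by rewrite (has_dim_leq h h') (has_dim_leq h' h).
Qed.

End HasDim.

Section Multihomogeneous.
Variable K : fieldType.

Lemma multihomog0 a b c : multihomog a b c (0 : coord_poly K).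
Proof. by move=> m; rewrite msupp0. Qed.

Lemma multihomogD a b c (f g : coord_poly K) :
  multihomog a b c f -> multihomog a b c g -> multihomog a b c (f + g).
Proof.
by move=> Hf Hg m /msuppD_le; rewrite mem_cat => /orP[/Hf|/Hg].
Qed.

Lemma multihomogZ a b c (k : K) (f : coord_poly K) :
  multihomog a b c f -> multihomog a b c (k *: f).
Proof. by move=> Hf m /msuppZ_le /Hf. Qed.

Lemma multihomog1 : multihomog 0 0 0 (1 : coord_poly K).
Proof.
by move=> m; rewrite msupp1 inE => /eqP ->; split; apply: big1 => i _; rewrite mnm0E.
Qed.

Lemma eval_at1 (x : point K) : eval_at 1 x = 1.
Proof. exact: meval1. Qed.

End Multihomogeneous.

Section Basis.
Variable K : numClosedFieldType.
Variable n : nat.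

(* On the chart [r23 = t s2], [r13 = t s1] and [q3 = t (q2 s1 - q1 s2)]; powers
   of [s2] are merged with [t] into [r23] as long as factors [t] are available. *)
Definition basis_mon (i a c : nat) : 'X_{1.. 2 + 3 + 3} :=
  [multinom nth 0%N [:: n - (a - minn a (i - (i - n))); a - minn a (i - (i - n));
     minn a (i - (i - n)); i - (i - n) - minn a (i - (i - n)); n - (i - (i - n));
     n - (i - n) - c; c; i - n]%N l | l < 2 + 3 + 3].

(** Here [i - (i - n)] is min(i, n), the joint degree in r23 and r13. The bound on [a] keeps the
    exponent of s2 at most n. *)
Lemma basis_mon_multihomog i a c : (i <= n + n)%N -> (a <= n + i - (i - n))%N ->
  (c <= n - (i - n))%N -> multihomog n n n ('X_[basis_mon i a c] : coord_poly K).
Proof.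
move=> hi ha hc m; rewrite msuppX inE => /eqP ->.
split; rewrite !big_ord_recl big_ord0 !mnmE /=; lia.
Qed.

Lemma eval_at_mon (m : 'X_{1.. 2 + 3 + 3}) (x : point K) :
  eval_at 'X_[m] x = \prod_(l < 2 + 3 + 3) row_mx (row_mx x.1.1 x.1.2) x.2 0 l ^+ m l.
Proof. exact: mevalX. Qed.

Lemma eval_basis_mon i a c (x t y : K) : (i <= n + n)%N -> (a <= n + i - (i - n))%N ->
  eval_at 'X_[basis_mon i a c] (chart x t y) = basis_fun n i a c x t y.
Proof.
move=> hi ha; rewrite eval_at_mon.
under eq_bigr do rewrite coord_pt mnmE.
rewrite !big_ord_recl big_ord0 /= !expr1n !mul1r !mulr1 !exprMn /basis_fun.
set a2 := minn _ _; have a2a : (a2 <= a)%N by apply: geq_minl.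
have a2j : (a2 <= i - (i - n))%N by apply: geq_minr.
have -> : x ^+ a = x ^+ (a - a2) * x ^+ a2 by rewrite -exprD subnK.
have -> : t ^+ i = t ^+ a2 * t ^+ (i - (i - n) - a2) * t ^+ (i - n).
  by rewrite -!exprD; congr (_ ^+ _); lia.
ring.
Qed.

Lemma regular_eval (f : coord_poly K) : multihomog n n n f -> regular n (eval_at f).
Proof.
move=> Hf x _; exists 0%N, 0%N, 0%N, f, 1; split=> // [||y _ _].
- exact: multihomog1.
- by rewrite eval_at1 oner_neq0.
- by rewrite eval_at1 divr1.
Qed.

(** The variables are removed in the order t, y, x. For y, only values other than x are used, where
    the factor [(y - x) ^+ (i - n)] cancels. *)
Lemma basis_fun_indep (C : nat -> nat -> nat -> K) :
  (forall x t y, \sum_(i < (n + n).+1) \sum_(a < (n + i).+1 - (i - n))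
     \sum_(c < n.+1 - (i - n)) C i a c * basis_fun n i a c x t y = 0) ->
  forall (i : 'I_(n + n).+1) (a : 'I_((n + i).+1 - (i - n))) (c : 'I_(n.+1 - (i - n))),
    C i a c = 0.
Proof.
move=> C0 i a c.
have C1 x y : \sum_(a < (n + i).+1 - (i - n)) \sum_(c < n.+1 - (i - n))
    C i a c * (x ^+ a * (y - x) ^+ (i - n) * y ^+ c) = 0.
  apply: (@poly_coefs0 _ (n + n).+1 (fun i => \sum_(a < (n + i).+1 - (i - n))
    \sum_(c < n.+1 - (i - n)) C i a c * (x ^+ a * (y - x) ^+ (i - n) * y ^+ c)) 1
    (oner_neq0 _)) => t _.
  rewrite -[RHS](C0 x t y); apply: eq_bigr => l _; rewrite mulr_suml.
  apply: eq_bigr => b _; rewrite mulr_suml; apply: eq_bigr => d _.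
  by rewrite /basis_fun; ring.
have C2 x : \sum_(a < (n + i).+1 - (i - n)) C i a c * x ^+ a = 0.
  apply: (@poly_coefs0 _ _ (fun c : 'I_(n.+1 - (i - n)) =>
    \sum_(a < (n + i).+1 - (i - n)) C i a c * x ^+ a) ('X - x%:P)) => [|y].
    by rewrite polyXsubC_eq0.
  rewrite hornerXsubC => yx; apply: (mulfI (expf_neq0 (i - n) yx)).
  rewrite mulr0 -[RHS](C1 x y) exchange_big mulr_sumr; apply: eq_bigr => d _.
  rewrite mulr_suml mulr_sumr; apply: eq_bigr => b _; ring.
exact: (@poly_coefs0 _ _ (fun a : 'I_((n + i).+1 - (i - n)) => C i a c) 1
  (oner_neq0 _) (fun x _ => C2 x) a).
Qed.

(** A range independent of i that contains all the index triples: the exponent of x is at most n +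
    min(i, n), hence at most 2n. *)
Definition box : finType := ('I_(n + n).+1 * 'I_(n + n).+1 * 'I_n.+1)%type.

Definition in_box (j : box) : bool :=
  (j.1.2 < (n + j.1.1).+1 - (j.1.1 - n))%N && (j.2 < n.+1 - (j.1.1 - n))%N.

(** The operation is arbitrary because the same reindexing serves linear combinations over [K] and
    the count of the basis. *)
Lemma big_box (R : Type) (idx : R) (op : Monoid.com_law idx) (F : nat -> nat -> nat -> R) :
  \big[op/idx]_(i < (n + n).+1) \big[op/idx]_(a < (n + i).+1 - (i - n))
    \big[op/idx]_(c < n.+1 - (i - n)) F i a c
  = \big[op/idx]_(j | in_box j) F j.1.1 j.1.2 j.2.
Proof.
transitivity (\big[op/idx]_(i < (n + n).+1) \big[op/idx]_(ac : 'I_(n + n).+1 * 'I_n.+1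
    | (ac.1 < (n + i).+1 - (i - n))%N && (ac.2 < n.+1 - (i - n))%N) F i ac.1 ac.2).
  apply: eq_bigr => i _; have lt_i := ltn_ord i.
  have h1 : ((n + i).+1 - (i - n) <= (n + n).+1)%N by lia.
  rewrite (big_ord_widen _ (fun a => \big[op/idx]_(c < n.+1 - (i - n)) F i a c) h1).
  under eq_bigr => a _ do rewrite (big_ord_widen _ (F i a) (leq_subr (i - n) n.+1)).
  by rewrite pair_big_dep.
rewrite pair_big_dep [RHS](reindex (fun j : 'I_(n + n).+1 * ('I_(n + n).+1 * 'I_n.+1) =>
  ((j.1, j.2.1), j.2.2))) //=.
by exists (fun j : box => (j.1.1, (j.1.2, j.2))) => [[i [a c]]|[[i a] c]].
Qed.

(** On the chart the monomials restrict to the functions [basis_fun], which gives independence. The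
    expansion of a section there defines a polynomial that agrees with it on the whole multicone by
    [regular_eq]. *)
Lemma has_dim_sections : has_dim (is_section (X := @bs_cone K) n n n) #|in_box|.
Proof.
pose mon (j : box) : coord_poly K := 'X_[basis_mon j.1.1 j.1.2 j.2].
have bounds (j : box) : in_box j -> [/\ (j.1.1 <= n + n)%N,
    (j.1.2 <= n + j.1.1 - (j.1.1 - n))%N & (j.2 <= n - (j.1.1 - n))%N].
  by case/andP => h1 h2; have := ltn_ord j.1.1; split; lia.
have comb (c : box -> K) : exists2 f : coord_poly K, multihomog n n n f &
    forall x, eval_at f x = \sum_(j | in_box j) c j * eval_at (mon j) x.
  exists (\sum_(j | in_box j) c j *: mon j) => [|x].
    apply: big_ind => [||j /bounds[h1 h2 h3]]; first exact: multihomog0.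
      by move=> f g; apply: multihomogD.
    by apply: multihomogZ; apply: basis_mon_multihomog.
  rewrite /eval_at raddf_sum; apply: eq_bigr => j _; exact: mevalZ.
have on_chart (c : box -> K) x t y :
    \sum_(j | in_box j) c j * eval_at (mon j) (chart x t y)
    = \sum_(i < (n + n).+1) \sum_(a < (n + i).+1 - (i - n)) \sum_(d < n.+1 - (i - n))
        c (inord i, inord a, inord d) * basis_fun n i a d x t y.
  rewrite (big_box _ (fun i a d => c (inord i, inord a, inord d) * basis_fun n i a d x t y)).
  apply: eq_bigr => j /bounds[h1 h2 _]; rewrite eval_basis_mon // !inord_val.
  by case: j {h1 h2} => -[].
apply: (has_dim_fin (e := fun j x => eval_at (mon j) (sval x))) => [c c0 j Pj|sigma].
  have := @basis_fun_indep (fun i a d => c (inord i, inord a, inord d)).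
  case/andP: (Pj) => h1 h2 H.
  have := H _ j.1.1 (Ordinal h1) (Ordinal h2).
  rewrite /= !inord_val; case: j {Pj h1 h2} => -[i a] d; apply => x t y.
  by rewrite -on_chart (c0 (exist _ (chart x t y) (bs_eqns_cone (chart_eqns x t y)))).
split=> [/section_regular[S regS DS]|[c Dc]].
  have [C HC] := chart_expand regS.
  pose c (j : box) := C j.1.1 j.1.2 j.2; have [f Hf Df] := comb c.
  exists c => x; rewrite DS -Df.
  apply: (regular_eq regS (regular_eval Hf)); last first.
    by apply: bs_cone_eqns; apply: svalP.
  move=> x1 t y; rewrite HC Df on_chart.
  apply: eq_bigr => i _; apply: eq_bigr => a _; apply: eq_bigr => d _.
  have := ltn_ord i; have := ltn_ord a; have := ltn_ord d => h3 h2 h1.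
  by rewrite /c /= !inordK //; lia.
have [f Hf Df] := comb c; move=> x.
exists 0%N, 0%N, 0%N, f, 1; split=> // [||y _].
- exact: multihomog1.
- by rewrite eval_at1 oner_neq0.
- by rewrite eval_at1 divr1 Df.
Qed.

End Basis.

(** * Counting the basis, and the Hilbert polynomial *)

Lemma card_in_box n : (2 * #|@in_box n| = 5 * n ^ 3 + 11 * n ^ 2 + 8 * n + 2)%N.
Proof.
rewrite -sum1_card -(big_box n _ (fun _ _ _ => 1%N)) /=.
have lin m : (2 * (\sum_(i < m) (n + i).+1) = m * (2 * n + m.+1))%N.
  elim: m => [|m IHm]; first by rewrite big_ord0 muln0.
  by rewrite big_ord_recr /= mulnDr IHm; lia.
have tri m : (2 * (\sum_(i < m) (m - i)) = m * m.+1)%N.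
  elim: m => [|m IHm]; first by rewrite big_ord0 muln0.
  by rewrite big_ord_recl mulnDr subn0 (eq_bigr (fun i : 'I_m => m - i)%N) // IHm; lia.
under eq_bigr do under eq_bigr do rewrite sum1_card card_ord.
under eq_bigr do rewrite sum_nat_const card_ord.
(* The sum is cut after i = n: up to there [i - n] is 0, and beyond it the range of the exponent of
   x has constant length 2n + 1. *)
rewrite -addSn big_split_ord /=.
transitivity (2 * (\sum_(i < n.+1) (n + i).+1 * n.+1
                   + \sum_(i < n) (n + n).+1 * (n - i)))%N.
  by congr (2 * (_ + _))%N; apply: eq_bigr => i _; have := ltn_ord i => lt_i;
    congr (_ * _)%N; lia.
rewrite -big_distrl -big_distrr /= mulnDr mulnA lin mulnCA tri.
ring.
Qed.

Theorem proposition1p3 (R : realType) (P : {poly rat}) :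
  is_Hilbert_poly (@bs_cone (complex R)) P <->
  P = 2^-1 *: (5 *: 'X^3 + 11 *: 'X^2 + 8 *: 'X + 2%:P).
Proof.
set Q := 2^-1 *: _.
have QE s : Q.[s%:R] = #|@in_box s|%:R.
  have two0 : 2 != 0 :> rat by rewrite pnatr_eq0.
  have E : 2 * #|@in_box s|%:R = 5 * s%:R ^+ 3 + 11 * s%:R ^+ 2 + 8 * s%:R + 2 :> rat.
    by rewrite -natrM card_in_box 3!natrD 3!natrM 2!natrX.
  apply: (mulfI two0); rewrite {}E hornerZ mulrA mulfV // mul1r.
  by rewrite !(hornerD, hornerZ, hornerXn, hornerX, hornerC).
split=> [[N HN]|->].
  (* Dimensions are unique, so both polynomials take the same values at all large integers. *)
  apply: (@poly_eq_eventually _ _ _ N) => s /HN[d dim_d ->].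
  by rewrite QE (has_dim_uniq dim_d (has_dim_sections (complex R) s)).
by exists 0%N => s _; exists #|@in_box s|; [exact: has_dim_sections|exact: QE].
Qed.
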